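(* Let $(\mathcal{A},\mathbf{m})$ be a multiarrangement in $\mathbb{Q}^l$ with $\mathcal{A}=\{H_1,\dots,H_n\}$, $H_i=\alpha_i^{-1}(0)$, where the $\alpha_i\in S_\mathbb{Z}=\mathbb{Z}[x_1,\dots,x_l]$ are linear forms such that no prime number divides any $\alpha_i$. Let $p$ be a good prime for $(\mathcal{A},\mathbf{m})$ that is not a zero divisor of $\operatorname{coker}(\varphi_\mathbb{Z})$. If $(\mathcal{A}_p,\mathbf{m})$ is free in $\mathbb{F}_p^l$ with exponents $(e_1,\dots,e_l)$, then $(\mathcal{A},\mathbf{m})$ is free in $\mathbb{Q}^l$ with exponents $(e_1,\dots,e_l)$.
   Context: For a field $\mathbb{K}$ and $R=\mathbb{K}[x_1,\dots,x_l]$, a multiarrangement with hyperplanes $\beta_i^{-1}(0)$ and multiplicities $\mathbf{m}_i\ge0$ has $D=\{\delta=\sum_j f_j\partial_{x_j}: f_j\in R,\ \delta(\beta_i)\in\beta_i^{\mathbf{m}_i}R\ \forall i\}$; it is free with exponents $(e_1,\dots,e_l)$ if $D$ is a free $R$-module with a basis of homogeneous derivations of polynomial degrees $e_1,\dots,e_l$. Let $\pi_p\colon S_\mathbb{Z}\to\mathbb{F}_p[x_1,\dots,x_l]$ be reduction mod $p$. A prime $p$ is good if $\pi_p(\alpha_i)\ne\pi_p(\alpha_j)$ for $i\ne j$; then $(\mathcal{A}_p,\mathbf{m})$ is the multiarrangement in $\mathbb{F}_p^l$ with hyperplanes $\pi_p(\alpha_i)^{-1}(0)$ of multiplicities $\mathbf{m}(H_i)$.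 Let $M(\mathcal{A},\mathbf{m})\subseteq S_\mathbb{Z}^n$ be generated by $\alpha_i^{\mathbf{m}(H_i)}e_i$, $A(\mathcal{A})=(\partial\alpha_i/\partial x_j)_{i,j}$, and $\varphi_\mathbb{Z}\colon S_\mathbb{Z}^l\to S_\mathbb{Z}^n/M(\mathcal{A},\mathbf{m})$, $g\mapsto A(\mathcal{A})g$. $p$ is a zero divisor of an $S_\mathbb{Z}$-module $N$ if $pv=0$ for some nonzero $v\in N$. *)

(* Defs.v *)
From HB Require Import structures.
From mathcomp Require Import all_boot all_order all_algebra.
From mathcomp Require Import mpoly.
Set Implicit Arguments. Unset Strict Implicit. Unset Printing Implicit Defensive.
Import GRing.Theory.
Local Open Scope ring_scope.

(* A derivation delta = sum_j f_j d/dx_j on K[x_1..x_l] is given by its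
   coefficient vector f : 'I_l -> {mpoly K[l]}. *)
Definition der_app (R : comRingType) (l : nat)
  (f : 'I_l -> {mpoly R[l]}) (b : {mpoly R[l]}) : {mpoly R[l]} :=
  \sum_(j < l) f j * b^`M(j).

Definition Dmod (F : fieldType) (l n : nat)
  (beta : 'I_n -> {mpoly F[l]}) (m : 'I_n -> nat)
  (f : 'I_l -> {mpoly F[l]}) : Prop :=
  forall i : 'I_n, exists q : {mpoly F[l]}, der_app f (beta i) = beta i ^+ m i * q.

Definition free_with_exponents (F : fieldType) (l n : nat)
  (beta : 'I_n -> {mpoly F[l]}) (m : 'I_n -> nat) (e : 'I_l -> nat) : Prop :=
  exists theta : 'I_l -> 'I_l -> {mpoly F[l]},
    [/\ forall k, Dmod beta m (theta k),
        forall k j, theta k j \is (e k).-homog,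
        forall f, Dmod beta m f ->
          exists g : 'I_l -> {mpoly F[l]},
            forall j, f j = \sum_(k < l) g k * theta k j
      &
        forall g : 'I_l -> {mpoly F[l]},
          (forall j, \sum_(k < l) g k * theta k j = 0) -> forall k, g k = 0].

Definition red_p (p l : nat) (a : {mpoly int[l]}) : {mpoly 'F_p[l]} :=
  map_mpoly (fun z : int => z%:~R) a.
Definition to_Q (l : nat) (a : {mpoly int[l]}) : {mpoly rat[l]} :=
  map_mpoly (fun z : int => z%:~R) a.

Definition good_prime (p l n : nat) (alpha : 'I_n -> {mpoly int[l]}) : Prop :=
  prime p /\ forall i j : 'I_n, i != j -> red_p p (alpha i) != red_p p (alpha j).

(* The submodule M(A,m) + im(A(A)) of S_Z^n ; coker(phi_Z) is S_Z^n modulo it.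
   A(A)g has i-th entry sum_j (d alpha_i / d x_j) g_j. *)
Definition coker_rel (l n : nat) (alpha : 'I_n -> {mpoly int[l]}) (m : 'I_n -> nat)
  (w : 'I_n -> {mpoly int[l]}) : Prop :=
  exists (g : 'I_l -> {mpoly int[l]}) (c : 'I_n -> {mpoly int[l]}),
    forall i, w i = \sum_(j < l) (alpha i)^`M(j) * g j + c i * alpha i ^+ m i.

Definition zero_divisor_coker (p l n : nat) (alpha : 'I_n -> {mpoly int[l]})
  (m : 'I_n -> nat) : Prop :=
  exists v : 'I_n -> {mpoly int[l]},
    ~ coker_rel alpha m v /\ coker_rel alpha m (fun i => (p%:R : {mpoly int[l]}) * v i).

(* Main.v *)
(** Let [D_Z] be the module of integral derivations of [(A, m)], the kernel of
    [phi_Z].  Since [p] is not a zero divisor of [coker phi_Z], every derivation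
    in [D(A_p, m)] lifts to [D_Z]; since the [alpha_i] are nonzero mod [p],
    [p f \in D_Z] forces [f \in D_Z].  Lift the given basis to homogeneous
    elements [theta_k] of [D_Z].  A relation among the [theta_k] is divisible by
    every power of [p], hence trivial.  Conversely every [f \in D_Z] lies, modulo
    every power of [p], in the span of the [theta_k]; in bounded degree this is
    a finite linear system over [Z], so [f] is a rational combination. *)
Require Import Defs.
From HB Require Import structures.
From mathcomp Require Import all_boot all_order all_algebra.
From mathcomp Require Import mpoly ring.
From Stdlib Require Import Classical_Prop.
Import GRing.Theory Num.Theory.
Set Implicit Arguments.
Unset Strict Implicit.
Unset Printing Implicit Defensive.
Local Open Scope ring_scope.

(** * Reduction mod [p] and extension to the rationals, as ring morphisms compatible with
    derivations *)

HB.instance Definition _ (p l : nat) :=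
  GRing.RMorphism.copy (@red_p p l)
    (map_mpoly (intmul 1 : {rmorphism int -> 'F_p})).
HB.instance Definition _ (l : nat) :=
  GRing.RMorphism.copy (@to_Q l) (map_mpoly (intmul 1 : {rmorphism int -> rat})).

Lemma mcoeff_red_p (p l : nat) (a : {mpoly int[l]}) (mu : 'X_{1..l}) :
  (red_p p a)@_mu = (a@_mu)%:~R.
Proof. exact: (mcoeff_map_mpoly (intmul 1 : {additive int -> 'F_p})). Qed.

Lemma mcoeff_to_Q (l : nat) (a : {mpoly int[l]}) (mu : 'X_{1..l}) :
  (to_Q a)@_mu = (a@_mu)%:~R.
Proof. exact: (mcoeff_map_mpoly (intmul 1 : {additive int -> rat})). Qed.

Lemma to_Q_inj (l : nat) : injective (@to_Q l).
Proof.
move=> a b /mpolyP eq_ab; apply/mpolyP => mu.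
by have := eq_ab mu; rewrite !mcoeff_to_Q => /intr_inj.
Qed.

Lemma red_p_mderiv (p l : nat) (a : {mpoly int[l]}) (j : 'I_l) :
  (red_p p a)^`M(j) = red_p p a^`M(j).
Proof.
by apply/mpolyP => mu; rewrite mcoeff_deriv !mcoeff_red_p mcoeff_deriv rmorphMn.
Qed.

Lemma to_Q_mderiv (l : nat) (a : {mpoly int[l]}) (j : 'I_l) :
  (to_Q a)^`M(j) = to_Q a^`M(j).
Proof.
by apply/mpolyP => mu; rewrite mcoeff_deriv !mcoeff_to_Q mcoeff_deriv rmorphMn.
Qed.

Lemma red_p_der_app (p l : nat) (f : 'I_l -> {mpoly int[l]}) (a : {mpoly int[l]}) :
  red_p p (der_app f a) = der_app (fun j => red_p p (f j)) (red_p p a).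
Proof.
rewrite /der_app rmorph_sum; apply: eq_bigr => j _.
by rewrite rmorphM /= red_p_mderiv.
Qed.

Lemma to_Q_der_app (l : nat) (f : 'I_l -> {mpoly int[l]}) (a : {mpoly int[l]}) :
  to_Q (der_app f a) = der_app (fun j => to_Q (f j)) (to_Q a).
Proof.
rewrite /der_app rmorph_sum; apply: eq_bigr => j _.
by rewrite rmorphM /= to_Q_mderiv.
Qed.

Lemma der_appD (R : comNzRingType) (l : nat) (f g : 'I_l -> {mpoly R[l]})
    (b : {mpoly R[l]}) :
  der_app (fun j => f j + g j) b = der_app f b + der_app g b.
Proof. by rewrite /der_app -big_split; apply: eq_bigr => j _; rewrite mulrDl. Qed.

Lemma der_appM (R : comNzRingType) (l : nat) (c : {mpoly R[l]})
    (f : 'I_l -> {mpoly R[l]}) (b : {mpoly R[l]}) :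
  der_app (fun j => c * f j) b = c * der_app f b.
Proof. by rewrite /der_app big_distrr; apply: eq_bigr => j _ /=; rewrite mulrA. Qed.

Lemma der_app_sum (R : comNzRingType) (l : nat) (I : finType)
    (c : I -> {mpoly R[l]}) (f : I -> 'I_l -> {mpoly R[l]}) (b : {mpoly R[l]}) :
  der_app (fun j => \sum_i c i * f i j) b = \sum_i c i * der_app (f i) b.
Proof.
rewrite /der_app; under eq_bigr do rewrite big_distrl.
rewrite exchange_big; apply: eq_bigr => i _; rewrite big_distrr.
by apply: eq_bigr => j _ /=; rewrite mulrA.
Qed.

(** * Integral lifts and divisibility by [p] *)

Lemma red_p_surj (p l : nat) (a : {mpoly 'F_p[l]}) :
  exists b : {mpoly int[l]}, red_p p b = a.
Proof.
exists (\sum_(mu : 'X_{1..l < msize a}) (nat_of_ord a@_mu)%:Z *: 'X_[mu]).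
rewrite [RHS](mpolywE (leqnn _)) rmorph_sum; apply: eq_bigr => mu _.
rewrite [LHS](map_mpolyZ (intmul 1 : {rmorphism int -> 'F_p})) map_mpolyX.
by congr (_ *: _); exact: natr_Zp.
Qed.

Lemma red_p_eq0 (p l : nat) (a : {mpoly int[l]}) :
  prime p -> red_p p a = 0 -> exists r, a = (p%:R : {mpoly int[l]}) * r.
Proof.
move=> p_pr /mpolyP a0.
exists (\sum_(mu : 'X_{1..l < msize a}) (a@_mu %/ p%:Z)%Z *: 'X_[mu]).
rewrite {1}[a](mpolywE (leqnn _)) big_distrr; apply: eq_bigr => mu _ /=.
rewrite -scalerAr mulr_natl -scaler_nat scalerA natz; congr (_ *: _).
have: (p%:Z %| a@_mu)%Z.
  by rewrite (dvdz_pcharf (pchar_Fp p_pr)) -mcoeff_red_p a0 mcoeff0.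
by move/divzK=> ->.
Qed.

(** * Homogeneous components and coefficients of products *)

(** Multiplication by [a] shifts degrees by [e], so a single component of [g] can contribute. The
    test [e <= d] guards the truncated subtraction [d - e]. *)
Lemma pihomogMr (R : comNzRingType) (l d e : nat) (g a : {mpoly R[l]}) :
  a \is e.-homog ->
  pihomog mdeg d (g * a) = if (e <= d)%N then pihomog mdeg (d - e)%N g * a else 0.
Proof.
(* The bound is padded with [d.+1] so that degree [d - e] occurs in the partition even where [g] has
   no such component. *)
move=> a_hom; pose k := maxn (msize g) d.+1.
rewrite {1}(pihomog_partitionE (leq_maxl (msize g) d.+1)) -/k.
rewrite big_distrl raddf_sum /=.
have hom i : pihomog mdeg i g * a \is (i + e)%N.-homog.
  by apply: dhomogM => //; apply: pihomogP.
case: ifP => [le_ed|/negbT]; last first.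
  rewrite -ltnNge => lt_de; apply: big1 => i _.
  apply: pihomog_ne0 (hom i); rewrite neq_ltn orbC.
  by rewrite (leq_trans lt_de) ?leq_addl.
have lt_k : (d - e < k)%N by rewrite (@leq_trans d.+1) ?ltnS ?leq_subr ?leq_maxr.
rewrite (bigD1 (Ordinal lt_k)) //= pihomog_dE; last first.
  by have := hom (d - e)%N; rewrite subnK.
rewrite big1 ?addr0 // => i ne_i; apply: pihomog_ne0 (hom i).
apply: contra ne_i => /eqP eq_d; apply/eqP/val_inj => /=.
by rewrite -eq_d addnK.
Qed.

Lemma mcoeff_pihomog (R : comNzRingType) (l d : nat) (a : {mpoly R[l]})
    (mu : 'X_{1..l}) :
  (pihomog mdeg d a)@_mu = if mdeg mu == d then a@_mu else 0.
Proof.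
have coef0 i : mdeg mu != i -> (pihomog mdeg i a)@_mu = 0.
  exact: dhomog_nemf_coeff (pihomogP _ _ _).
case: eqP => [<-|/eqP/coef0//].
rewrite [a in RHS](pihomog_partitionE (leq_maxl (msize a) (mdeg mu).+1)).
have lt_k : (mdeg mu < maxn (msize a) (mdeg mu).+1)%N by rewrite leq_maxr.
rewrite [RHS]raddf_sum (bigD1 (Ordinal lt_k)) //= big1 ?addr0 // => i ne_i.
by apply: coef0; rewrite eq_sym.
Qed.

Lemma mcoeff_sum_bmnm (R : nzRingType) (l d : nat) (c : 'X_{1..l < d} -> R)
    (mu : 'X_{1..l < d}) :
  (\sum_nu c nu *: 'X_[nu])@_mu = c mu.
Proof.
rewrite raddf_sum (bigD1 mu) //= mcoeffZ mcoeffX eqxx mulr1 big1 ?addr0 // => nu.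
by rewrite mcoeffZ mcoeffX bmeqP => /negbTE ->; rewrite mulr0.
Qed.

(** Turns a product into a finite linear expression in the coefficients of [g], indexed by a set
    that does not depend on [mu]; this is what makes the system for the span finite. *)
Lemma mcoeffM_lt (R : comNzRingType) (l d : nat) (g a : {mpoly R[l]})
    (mu : 'X_{1..l}) : (mdeg mu < d)%N ->
  (g * a)@_mu = \sum_(nu : 'X_{1..l < d})
    g@_nu * (if (nu <= mu)%MM then a@_(mu - nu) else 0).
Proof.
move=> lt_d; rewrite [LHS](mcoeff_poly_mul_lin _ _ lt_d) big_mkcond.
by apply: eq_bigr => nu _; case: ifP; rewrite ?mulr0.
Qed.

(** * Common denominators, and linear systems solvable modulo all powers of [p] *)

Lemma clear_denominators (T : finType) (a : T -> rat) :
  exists (N : int) (b : T -> int), N != 0 /\ forall t, (b t)%:~R = N%:~R * a t.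
Proof.
exists (\prod_t denq (a t)), (fun t => numq (a t) * \prod_(s | s != t) denq (a s)).
split; first by apply/prodf_neq0 => t _; rewrite denq_neq0.
move=> t; rewrite [in RHS](bigD1 t) //= !intrM -{3}[a t]divq_num_den.
by rewrite mulrAC [(denq _)%:~R * _]mulrC divfK ?intr_eq0 ?denq_neq0.
Qed.

Lemma to_Q_clear (l : nat) (T : finType) (a : T -> {mpoly rat[l]}) :
  exists (N : int) (b : T -> {mpoly int[l]}),
    N != 0 /\ forall t, to_Q (b t) = N%:~R * a t.
Proof.
pose k := (\max_t msize (a t))%N.
have [N [b [N0 bP]]] :=
  clear_denominators (fun t : T * 'X_{1..l < k} => (a t.1)@_t.2).
exists N, (fun t => \sum_(mu : 'X_{1..l < k}) b (t, mu) *: 'X_[mu]); split=> // t.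
have le_k : (msize (a t) <= k)%N by apply: (leq_bigmax t).
rewrite [a t in RHS](mpolywE le_k) rmorph_sum big_distrr.
apply: eq_bigr => mu _ /=.
rewrite [LHS](map_mpolyZ (intmul 1 : {rmorphism int -> rat})) map_mpolyX.
by rewrite /= bP -scalerA scaler_int mulrzl.
Qed.

(** The single exponent [|z|] suffices: [p ^ |z|] exceeds [|z|], so it cannot divide a nonzero
    [z]. *)
Lemma pow_dvd_eq0 (p : nat) (z : int) :
  (1 < p)%N -> (forall N, exists w : int, z = p%:Z ^+ N * w) -> z = 0.
Proof.
move=> p_gt1 /(_ `|z|%N)[w zE]; apply/eqP; rewrite -absz_eq0; apply: contraTT isT.
move=> z0; have: (p ^ `|z| %| `|z|)%N.
  by rewrite {2}zE abszM abszX dvdn_mulr.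
move/(dvdn_leq _); rewrite lt0n z0 => /(_ isT).
by rewrite leqNgt ltn_expl.
Qed.

(* If [v] were not in the rational row space of [B], an integral column killing
   [B] but not [v] would send [v] to a nonzero integer divisible by every power
   of [p]. *)
Lemma rational_combination (I J : finType) (B : I -> J -> int) (v : J -> int) (p : nat) :
  (1 < p)%N ->
  (forall N, exists (u : I -> int) (w : J -> int),
     forall j, v j = \sum_i u i * B i j + p%:Z ^+ N * w j) ->
  exists u : I -> rat, forall j, (v j)%:~R = \sum_i u i * (B i j)%:~R.
Proof.
move=> p_gt1 approx.
pose BQ : 'M[rat]_(#|I|, #|J|) := \matrix_(i, j) (B (enum_val i) (enum_val j))%:~R.
pose vQ : 'rV[rat]_#|J| := \row_j (v (enum_val j))%:~R.
have [/submxP[u uP]|] := boolP (vQ <= BQ)%MS.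
  exists (fun i => u 0 (enum_rank i)) => j.
  have /matrixP/(_ 0 (enum_rank j)) := uP; rewrite !mxE enum_rankK => ->.
  rewrite (reindex _ (onW_bij _ (enum_rank_bij I))) /=; apply: eq_bigr => i _.
  by rewrite mxE !enum_rankK.
rewrite submxE => /rV0Pn[x vx0].
pose K := cokermx BQ.
have [N [b [N0 bP]]] := clear_denominators (fun j : J => K (enum_rank j) x).
have sumE (a : J -> int) :
    (\sum_j a j * b j)%:~R
      = N%:~R * \sum_(j < #|J|) (a (enum_val j))%:~R * K j x :> rat.
  rewrite rmorph_sum big_distrr /=. 
  rewrite [RHS](reindex _ (onW_bij _ (enum_rank_bij J))) /=.
  apply: eq_bigr => j _.
  by rewrite rmorphM /= bP enum_rankK mulrCA.
have Bb i : \sum_j B i j * b j = 0.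
  apply: (@intr_inj rat); rewrite sumE.
  have /matrixP/(_ (enum_rank i) x) := mulmx_coker BQ; rewrite !mxE.
  under eq_bigr do rewrite mxE enum_rankK.
  by move=> ->; rewrite mulr0.
have vb : \sum_j v j * b j = 0.
  apply: (pow_dvd_eq0 p_gt1) => M; have [u [w vE]] := approx M.
  exists (\sum_j w j * b j); rewrite big_distrr /=.
  under eq_bigr do rewrite vE mulrDl big_distrl /=.
  rewrite big_split exchange_big /= [X in X + _]big1 ?add0r => [|i _].
    by apply: eq_bigr => j _; rewrite mulrA.
  by under eq_bigr do rewrite -mulrA; rewrite -big_distrr /= Bb mulr0.
case/negP: vx0; move/eqP: (sumE v); rewrite vb eq_sym mulf_eq0 intr_eq0.
rewrite (negbTE N0) mxE /=; move/eqP => {2}<-; apply/eqP.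
by apply: eq_bigr => j _; rewrite mxE.
Qed.

(** * The module of integral derivations and its behaviour under reduction mod [p] *)

Section Lift.

Variables (l n : nat) (alpha : 'I_n -> {mpoly int[l]}) (m : 'I_n -> nat) (p : nat).
Hypothesis alpha_hom : forall i, alpha i \is 1.-homog.
Hypothesis p_pr : prime p.
Hypothesis alpha_p : forall i, red_p p (alpha i) != 0.
Hypothesis coker_p : ~ zero_divisor_coker p alpha m.

Definition DZ (f : 'I_l -> {mpoly int[l]}) : Prop :=
  forall i, exists q, der_app f (alpha i) = alpha i ^+ m i * q.

Let pP : {mpoly int[l]} := p%:R.

Let red_pP : red_p p pP = 0.
Proof. by rewrite /pP rmorph_nat -mpolyC_nat pchar_Fp_0 ?mpolyC0. Qed.

Let pP0 : pP != 0.
Proof. by rewrite /pP -mpolyC_nat mpolyC_eq0 pnatr_eq0 -lt0n prime_gt0. Qed.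

Lemma DZD f g : DZ f -> DZ g -> DZ (fun j => f j + g j).
Proof.
move=> Df Dg i; have [q qE] := Df i; have [r rE] := Dg i.
by exists (q + r); rewrite der_appD qE rE mulrDr.
Qed.

Lemma DZM c f : DZ f -> DZ (fun j => c * f j).
Proof.
by move=> Df i; have [q qE] := Df i; exists (c * q); rewrite der_appM qE mulrCA.
Qed.

Lemma DZ_sum (I : finType) c (f : I -> _) :
  (forall i, DZ (f i)) -> DZ (fun j => \sum_i c i * f i j).
Proof.
move=> Df k; have /fin_all_exists[q qE] i := Df i k.
exists (\sum_i c i * q i); rewrite der_app_sum big_distrr.
by apply: eq_bigr => i _; rewrite qE mulrCA.
Qed.

(** Modulo [p] the defining equation reads [0 = alpha i ^+ m i * q]. Polynomials over ['F_p] form a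
    domain and [alpha i] is nonzero there, so [p] divides [q] and can be cancelled. *)
Lemma DZ_divp f : DZ (fun j => pP * f j) -> DZ f.
Proof.
move=> Df i; have [q qE] := Df i; move: qE; rewrite der_appM => qE.
have /red_p_eq0[//|r rE] : red_p p q = 0.
  have/eqP := congr1 (@red_p p l) qE; rewrite !rmorphM /= red_pP mul0r eq_sym.
  by rewrite mulf_eq0 rmorphXn expf_eq0 (negbTE (alpha_p i)) andbF => /eqP.
by exists r; apply: (mulfI pP0); rewrite qE rE mulrCA.
Qed.

(* If [g] lifts [f], then [A(A) g = p w] modulo [M(A, m)]; regularity of [p] on
   the cokernel gives [w = A(A) h] modulo [M(A, m)], and [g - p h] is the lift. *)
Lemma DZ_lift f : Dmod (fun i => red_p p (alpha i)) m f ->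
  exists2 g, DZ g & forall j, red_p p (g j) = f j.
Proof.
move=> Df; have /fin_all_exists[g gE] j := red_p_surj (f j).
have /fin_all_exists[q qE] := Df.
have /fin_all_exists[c cE] i := red_p_surj (q i).
have /fin_all_exists[w wE] i :
    exists w, der_app g (alpha i) - alpha i ^+ m i * c i = pP * w.
  apply: (red_p_eq0 p_pr); rewrite rmorphB rmorphM rmorphXn /= red_p_der_app cE.
  rewrite -qE; apply/eqP; rewrite subr_eq0; apply/eqP.
  by apply: eq_bigr => j _; rewrite gE.
have /NNPP[h [d hE]] : ~ ~ coker_rel alpha m w.
  move=> not_w; apply: coker_p; exists w; split=> //; exists g, (fun i => - c i) => i.
  rewrite -wE mulNr [c i * _]mulrC; congr (_ - _).
  by apply: eq_bigr => j _; rewrite mulrC.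
exists (fun j => g j + (- pP) * h j) => [i|j].
  exists (c i + pP * d i); rewrite der_appD der_appM.
  have -> : der_app g (alpha i) = pP * w i + alpha i ^+ m i * c i.
    by rewrite -wE subrK.
  have -> : w i = der_app h (alpha i) + d i * alpha i ^+ m i.
    by rewrite hE; congr (_ + _); apply: eq_bigr => j _; rewrite mulrC.
  ring.
by rewrite rmorphD rmorphM rmorphN /= red_pP oppr0 mul0r addr0.
Qed.

(** The partial derivatives of a linear form are constants, so applying the derivation to [alpha i]
    preserves degrees; as [alpha i ^+ m i] is homogeneous, divisibility by it can be read off in
    each degree. *)
Lemma DZ_pihomog d f : DZ f -> DZ (fun j => pihomog mdeg d (f j)).
Proof.
move=> Df i; have [q qE] := Df i.
have dalpha j : (alpha i)^`M(j) \is 0.-homog.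
  apply/dhomogP => mu; rewrite mcoeff_msupp mcoeff_deriv => nz.
  have: (alpha i)@_(mu + U_(j)) != 0 by apply: contraNneq nz => ->; rewrite mul0rn.
  rewrite -mcoeff_msupp => /(dhomog_mf (alpha_hom i)).
  by rewrite /= mdegD mdeg1 addn1 => -[].
have -> : der_app (fun j => pihomog mdeg d (f j)) (alpha i)
    = pihomog mdeg d (der_app f (alpha i)).
  rewrite raddf_sum; apply: eq_bigr => j _ /=.
  by rewrite (pihomogMr _ _ (dalpha j)) subn0.
have am : alpha i ^+ m i \is (m i).-homog.
  by have := dhomogMn (m i) (alpha_hom i); rewrite mul1n.
rewrite qE mulrC (pihomogMr _ _ am); case: ifP => _.
  by eexists; rewrite mulrC.
by exists 0; rewrite mulr0.
Qed.

(** * Freeness and spanning for integral lifts of a basis mod [p] *)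

Section Basis.

Variables (e : 'I_l -> nat) (theta : 'I_l -> 'I_l -> {mpoly int[l]}).
Hypothesis theta_DZ : forall k, DZ (theta k).
Hypothesis theta_hom : forall k j, theta k j \is (e k).-homog.
Hypothesis theta_span : forall f, Dmod (fun i => red_p p (alpha i)) m f ->
  exists g : 'I_l -> {mpoly 'F_p[l]},
    forall j, f j = \sum_(k < l) g k * red_p p (theta k j).
Hypothesis theta_free : forall g : 'I_l -> {mpoly 'F_p[l]},
  (forall j, \sum_(k < l) g k * red_p p (theta k j) = 0) -> forall k, g k = 0.

Lemma mcoeff_pexpM (M : nat) (a : {mpoly int[l]}) (mu : 'X_{1..l}) :
  (pP ^+ M * a)@_mu = p%:Z ^+ M * a@_mu.
Proof. by rewrite /pP -!natrX mulr_natl mcoeffMn -mulr_natl natrX natz. Qed.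

(** The remainder [w] is kept in [DZ] so that it can be reduced mod [p] and expanded again; the new
    remainder is in [DZ] by [DZ_divp]. *)
Lemma DZ_span_mod M f : DZ f ->
  exists (g : 'I_l -> {mpoly int[l]}) (w : 'I_l -> {mpoly int[l]}),
    DZ w /\ forall j, f j = \sum_k g k * theta k j + pP ^+ M * w j.
Proof.
move=> Df; elim: M => [|M [g [w [Dw fE]]]].
  exists (fun=> 0), f; split=> // j.
  by rewrite expr0 mul1r big1 ?add0r // => k _; rewrite mul0r.
have Dp_w : Dmod (fun i => red_p p (alpha i)) m (fun j => red_p p (w j)).
  move=> i; have [q qE] := Dw i; exists (red_p p q).
  by rewrite -red_p_der_app qE rmorphM rmorphXn.
have [hp hpE] := theta_span Dp_w.
have /fin_all_exists[h hE] k := red_p_surj (hp k).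
(* The difference is written with a factor [- 1] to match [DZM]. *)
have /fin_all_exists[w' w'E] j :
    exists r, w j + - 1 * \sum_k h k * theta k j = pP * r.
  apply: (red_p_eq0 p_pr); rewrite rmorphD rmorphM rmorphN1 /= hpE rmorph_sum.
  rewrite mulN1r; apply/eqP; rewrite subr_eq0; apply/eqP.
  by apply: eq_bigr => k _; rewrite rmorphM /= hE.
exists (fun k => g k + pP ^+ M * h k), w'; split=> [|j].
  apply: DZ_divp => i.
  have [q qE] := DZD Dw (DZM (- 1) (DZ_sum h theta_DZ)) i.
  by exists q; rewrite -qE; apply: eq_bigr => j _; rewrite w'E.
rewrite fE; under [in RHS]eq_bigr do rewrite mulrDl -mulrA.
rewrite big_split /= -big_distrr /= exprSr -mulrA -w'E /=; ring.
Qed.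

(** Descent: independence mod [p] makes every coefficient divisible by [p], and the quotients
    satisfy the same relation. *)
Lemma theta_free_Z (b : 'I_l -> {mpoly int[l]}) :
  (forall j, \sum_k b k * theta k j = 0) -> forall k, b k = 0.
Proof.
move=> b0; have pdiv M : exists2 c : 'I_l -> {mpoly int[l]},
    forall k, b k = pP ^+ M * c k & forall j, \sum_k c k * theta k j = 0.
  elim: M => [|M [c bE c0]]; first by exists b => // k; rewrite expr0 mul1r.
  have /fin_all_exists[d cE] k : exists r, c k = pP * r.
    apply: (red_p_eq0 p_pr); move: k; apply: theta_free => j.
    rewrite -[RHS](rmorph0 (@red_p p l)) -[in RHS](c0 j) rmorph_sum.
    by apply: eq_bigr => k _; rewrite rmorphM.
  exists d => [k|j]; first by rewrite bE cE exprSr mulrA.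
  apply: (mulfI pP0); rewrite mulr0 -[RHS](c0 j) big_distrr.
  by apply: eq_bigr => k _ /=; rewrite cE mulrA.
move=> k; apply/mpolyP => mu; rewrite mcoeff0.
apply: (pow_dvd_eq0 (prime_gt1 p_pr)) => M; have [c bE _] := pdiv M.
by exists (c k)@_mu; rewrite bE mcoeff_pexpM.
Qed.

Lemma theta_free_Q (g : 'I_l -> {mpoly rat[l]}) :
  (forall j, \sum_k g k * to_Q (theta k j) = 0) -> forall k, g k = 0.
Proof.
move=> g0 k; have [N [b [N0 bE]]] := to_Q_clear g.
have b0 : forall k, b k = 0.
  apply: theta_free_Z => j; apply: to_Q_inj; rewrite rmorph0 rmorph_sum.
  under eq_bigr do rewrite rmorphM /= bE -mulrA.
  by rewrite -big_distrr /= g0 mulr0.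
have /eqP := bE k; rewrite b0 rmorph0 eq_sym mulf_eq0 => /orP[|/eqP//].
by rewrite -(rmorph_int (@mpolyC l rat)) mpolyC_eq0 intr_eq0 (negbTE N0).
Qed.

Lemma theta_span_Q (f : 'I_l -> {mpoly rat[l]}) :
  Dmod (fun i => to_Q (alpha i)) m f ->
  exists g : 'I_l -> {mpoly rat[l]},
    forall j, f j = \sum_k g k * to_Q (theta k j).
Proof.
move=> /fin_all_exists[q qE].
(* The quotients [q] are cleared with the same [N] as [f], so that they witness that the multiple of
   [f] by [N] lies in [DZ]. *)
have [N [b [N0 bE]]] := to_Q_clear (fun t : 'I_l + 'I_n =>
  match t with inl j => f j | inr i => q i end).
have D_b : DZ (fun j => b (inl j)).
  move=> i; exists (b (inr i)); apply: to_Q_inj.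
  rewrite to_Q_der_app rmorphM rmorphXn /= bE mulrCA -qE -der_appM.
  by apply: eq_bigr => j _; rewrite bE.
pose d := (\max_j msize (f j))%N.
(* Row [t] holds the coefficients, in degrees below [d], of the monomial [t.2] times [theta t.1]. *)
pose B (t s : 'I_l * 'X_{1..l < d}) :=
  if (t.2 <= s.2)%MM then (theta t.1 s.1)@_(s.2 - t.2) else 0.
have BE (g : 'I_l -> {mpoly int[l]}) (s : 'I_l * 'X_{1..l < d}) :
    (\sum_k g k * theta k s.1)@_s.2
      = \sum_(t : 'I_l * 'X_{1..l < d}) (g t.1)@_t.2 * B t s.
  rewrite raddf_sum.
  rewrite -(pair_bigA _ (fun k (nu : 'X_{1..l < d}) => (g k)@_nu * B (k, nu) s)) /=.
  by apply: eq_bigr => k _; rewrite (mcoeffM_lt _ _ (bmdeg s.2)).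
(* [DZ_span_mod] solves this system modulo each [p ^ M], which yields a rational solution. *)
have [u uE] : exists u : 'I_l * 'X_{1..l < d} -> rat, forall s : 'I_l * 'X_{1..l < d},
    ((b (inl s.1))@_(val s.2))%:~R = \sum_t u t * (B t s)%:~R.
  apply: (rational_combination (prime_gt1 p_pr)) => M.
  have [g [w [_ fE]]] := DZ_span_mod M D_b.
  exists (fun t => (g t.1)@_(val t.2)), (fun s => (w s.1)@_(val s.2)) => s.
  by rewrite fE mcoeffD mcoeff_pexpM BE.
pose G k := \sum_(nu : 'X_{1..l < d}) (N%:~R^-1 * u (k, nu)) *: 'X_[nu].
have fG j (mu : 'X_{1..l}) : (mdeg mu < d)%N ->
    (f j)@_mu = (\sum_k G k * to_Q (theta k j))@_mu.
  move=> lt_mu; pose s := (j, BMultinom lt_mu).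
  have NQ0 : N%:~R != 0 :> rat by rewrite intr_eq0.
  apply: (mulfI NQ0).
  have := uE s; rewrite -mcoeff_to_Q bE -(rmorph_int (@mpolyC l rat)) mcoeffCM => ->.
  rewrite raddf_sum big_distrr.
  rewrite (eq_bigr (fun t => u (t.1, t.2) * (B (t.1, t.2) s)%:~R)) => [|[]//].
  rewrite -(pair_bigA _ (fun k nu => u (k, nu) * (B (k, nu) s)%:~R)) /=.
  apply: eq_bigr => k _; rewrite (mcoeffM_lt _ _ lt_mu) big_distrr.
  apply: eq_bigr => nu _ /=; rewrite mcoeff_sum_bmnm -mulrA mulVKf //.
  by rewrite /B /=; case: ifP; rewrite ?mcoeff_to_Q.
(* [G] reproduces [f] only in degrees below [d], and its products with [theta] may have higher
   terms. Since [theta k] has degree [e k], keeping the components of [G k] in degrees [i - e k]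
   with [i < d] removes exactly those terms. *)
exists (fun k => \sum_(i < d | (e k <= i)%N) pihomog mdeg (i - e k) (G k)) => j.
have le_d : (msize (f j) <= d)%N by apply: (leq_bigmax j).
rewrite (pihomog_partitionE le_d).
have hom k : to_Q (theta k j) \is (e k).-homog.
  apply/dhomogP => mu; rewrite mcoeff_msupp mcoeff_to_Q intr_eq0 -mcoeff_msupp.
  exact: (dhomog_mf (theta_hom k j)).
under [RHS]eq_bigr do rewrite big_distrl big_mkcond.
rewrite exchange_big; apply: eq_bigr => i _ /=.
transitivity (pihomog mdeg i (\sum_k G k * to_Q (theta k j))).
  by apply/mpolyP => mu; rewrite !mcoeff_pihomog; case: eqP => // mu_i; rewrite fG ?mu_i.
by rewrite raddf_sum; apply: eq_bigr => k _; rewrite /= (pihomogMr _ _ (hom k)).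
Qed.

End Basis.

End Lift.

(** * Transfer of freeness and exponents from characteristic [p] to the rationals *)

Theorem theorem4p4 (l n : nat) (alpha : 'I_n -> {mpoly int[l]}) (m : 'I_n -> nat)
  (p : nat) (e : 'I_l -> nat) :
  (* the alpha_i are linear forms *)
  (forall i, alpha i \is 1.-homog) ->
  (* no prime number divides any alpha_i in S_Z *)
  (forall i (q : nat), prime q ->
     ~ exists r : {mpoly int[l]}, alpha i = (q%:R : {mpoly int[l]}) * r) ->
  (* the hyperplanes H_i are pairwise distinct (alpha_i, alpha_j not proportional) *)
  (forall i j : 'I_n, i != j ->
     ~ exists a b : int, [/\ a != 0, b != 0 & a *: alpha i = b *: alpha j]) ->
  good_prime p alpha ->
  ~ zero_divisor_coker p alpha m ->
  free_with_exponents (fun i => red_p p (alpha i)) m e ->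
  free_with_exponents (fun i => to_Q (alpha i)) m e.
Proof.
move=> alpha_hom alpha_prim _ [p_pr _] coker_p [theta [D_theta hom_theta span free]].
have alpha_p i : red_p p (alpha i) != 0.
  by apply/eqP => /(red_p_eq0 p_pr)/(alpha_prim i p p_pr).
have /fin_all_exists[Theta ThetaP] k : exists g : 'I_l -> {mpoly int[l]},
    [/\ DZ alpha m g, forall j, g j \is (e k).-homog
      & forall j, red_p p (g j) = theta k j].
  have [g Dg gE] := DZ_lift p_pr coker_p (D_theta k).
  (* The lift [g] need not be homogeneous. Its component of degree [e k] stays in [DZ] and still
     reduces to [theta k], which is homogeneous of that degree. *)
  exists (fun j => pihomog mdeg (e k) (g j)); split=> [|j|j].
  - exact: DZ_pihomog.
  - exact: pihomogP.
  - rewrite -[RHS](pihomog_dE (hom_theta k j)) -gE; apply/mpolyP => mu.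
    by rewrite mcoeff_red_p !mcoeff_pihomog mcoeff_red_p; case: ifP.
have ThetaE k j : red_p p (Theta k j) = theta k j by have [] := ThetaP k.
have hom_Theta k j : Theta k j \is (e k).-homog by have [] := ThetaP k.
have D_Theta k : DZ alpha m (Theta k) by have [] := ThetaP k.
exists (fun k j => to_Q (Theta k j)); split.
- move=> k i; have [q qE] := D_Theta k i; exists (to_Q q).
  by rewrite -to_Q_der_app qE rmorphM rmorphXn.
- move=> k j; apply/dhomogP => mu.
  rewrite mcoeff_msupp mcoeff_to_Q intr_eq0 -mcoeff_msupp.
  exact: (dhomog_mf (hom_Theta k j)).
- move=> f; apply: (theta_span_Q p_pr alpha_p D_Theta hom_Theta) => g Dg.
  have [c cE] := span g Dg; exists c => j; rewrite cE.
  by apply: eq_bigr => k _; rewrite ThetaE.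
- apply: (theta_free_Q p_pr) => g g0; apply: free => j; rewrite -[RHS](g0 j).
  by apply: eq_bigr => k _; rewrite ThetaE.
Qed.
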